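(* Let $n\in\mathbb{N}$, let $a\ge2$ be an integer, $k_1,\ldots,k_n\in\mathbb{N}$, $K=\operatorname{lcm}(k_1,\ldots,k_n)$, and let $f_1,\ldots,f_n,g_1,\ldots,g_n$ be arbitrary arithmetic functions. For each tuple $d_1|k_1,\ldots,d_n|k_n$ write $M=\operatorname{lcm}(d_1,\ldots,d_n)$, $L=K/M$, $F=\prod_{i=1}^n f_i(d_i)g_i(k_i/d_i)$, and put $G(j)=\prod_{i=1}^n s^{(a)}_{f_i,g_i,\mathbf 1}(k_i,j)$ for $j\in\mathbb{N}_0$. Then $$\sum_{j=1}^{K^a}\log\Gamma\Bigl(\frac{j}{K^a}\Bigr)G(j)=\frac{K^a}{2}\log(2\pi)\sum_{d_1|k_1,\ldots,d_n|k_n}\frac{F}{M^a}-\frac12\log(2\pi K^a)\prod_{i=1}^n(f_i*g_i)(k_i)+\frac a2\sum_{d_1|k_1,\ldots,d_n|k_n}(\log M)\,F,$$ $$\sum_{j=0}^{K^a}\binom{K^a}{j}G(j)=2^{K^a}\sum_{d_1|k_1,\ldots,d_n|k_n}\frac{F}{M^a}\sum_{\ell=1}^{M^a}(-1)^{\ell L^a}\cos^{K^a}\Bigl(\frac{\pi\ell}{M^a}\Bigr),$$ and for every integer $m\ge0$, $$\sum_{j=0}^{K^a-1}B_m\Bigl(\frac{j}{K^a}\Bigr)G(j)=\frac{B_m}{K^{a(m-1)}}\sum_{d_1|k_1,\ldots,d_n|k_n}M^{a(m-1)}F.$$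
   Context: An arithmetic function is a map $\mathbb{N}\to\mathbb{C}$; $(f*g)(n)=\sum_{d|n}f(d)g(n/d)$. For $a\in\mathbb{N}$ and $k\in\mathbb{N}$, $j\in\mathbb{N}_0$, $s^{(a)}_{f,g,\mathbf 1}(k,j)=\sum_{d|k,\ d^a|j} f(d)\,g(k/d)$ (for $j=0$ every $d^a$ divides $j$, so $s^{(a)}_{f,g,\mathbf 1}(k,0)=(f*g)(k)$). $\Gamma$ is the Gamma function. The Bernoulli polynomials are defined by $\frac{te^{xt}}{e^t-1}=\sum_{m\ge0}B_m(x)\frac{t^m}{m!}$ and $B_m=B_m(0)$ are the Bernoulli numbers. *)

(* Defs.v *)
From Stdlib Require Import Reals Lra Lia Arith List ClassicalEpsilon.
Import ListNotations.
Open Scope R_scope.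

Definition Cplx : Type := (R * R)%type.
Definition Czero : Cplx := (0, 0).
Definition Cone : Cplx := (1, 0).
Definition RtoC (r : R) : Cplx := (r, 0).
Definition Cadd (z w : Cplx) : Cplx := (fst z + fst w, snd z + snd w).
Definition Cmul (z w : Cplx) : Cplx :=
  (fst z * fst w - snd z * snd w, fst z * snd w + snd z * fst w).
Definition Cscale (r : R) (z : Cplx) : Cplx := (r * fst z, r * snd z).
Definition Cneg (z : Cplx) : Cplx := Cscale (-1) z.
Definition Csum (l : list Cplx) : Cplx := fold_right Cadd Czero l.
Definition Cprod (l : list Cplx) : Cplx := fold_right Cmul Cone l.
Definition Rsum (l : list R) : R := fold_right Rplus 0 l.
Definition Rprod (l : list R) : R := fold_right Rmult 1 l.

(* arithmetic functions N -> C (value at 0 is never used) *)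
Definition arith := nat -> Cplx.

Definition ndvd (d m : nat) : bool := Nat.eqb (Nat.modulo m d) 0.
Definition divisors (k : nat) : list nat := filter (fun d => ndvd d k) (seq 1 k).

Definition dirichlet (f g : arith) (k : nat) : Cplx :=
  Csum (map (fun d => Cmul (f d) (g (k / d)%nat)) (divisors k)).

Definition s_a (a : nat) (f g : arith) (k j : nat) : Cplx :=
  Csum (map (fun d => Cmul (f d) (g (k / d)%nat))
            (filter (fun d => ndvd (d ^ a) j) (divisors k))).

Fixpoint div_tuples (k : nat -> nat) (idx : list nat) : list (nat -> nat) :=
  match idx with
  | [] => [fun _ => 0%nat]
  | i :: is =>
      flat_map (fun d => map (fun t => fun j => if Nat.eqb j i then d else t j)
                             (div_tuples k is))
               (divisors (k i))
  end.

Definition lcm_list (l : list nat) : nat := fold_right Nat.lcm 1%nat l.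

(* ---------- Gamma function (Gauss' product limit, x > 0) ---------- *)
Definition gauss_seq (x : R) (n : nat) : R :=
  INR (fact n) * Rpower (INR n) x / Rprod (map (fun i => x + INR i) (seq 0 (S n))).
Definition Gamma (x : R) : R :=
  epsilon (inhabits 0) (fun l => Un_cv (gauss_seq x) l).
Definition lnGamma (x : R) : R := ln (Gamma x).

(* B_0 = 1, sum_{k=0}^{m} C(m+1,k) B_k = 0 for m >= 1  (so B_1 = -1/2),
   which is the convention of t/(e^t-1) = sum B_m t^m/m!. *)
Fixpoint bern_list (m : nat) : list R :=
  match m with
  | O => [1]
  | S p => let l := bern_list p in
           l ++ [ - (Rsum (map (fun k => C (S (S p)) k * nth k l 0) (seq 0 (S p))))
                  / INR (S (S p)) ]
  end.
Definition bernoulli (m : nat) : R := nth m (bern_list m) 0.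
Definition bernpoly (m : nat) (x : R) : R :=
  Rsum (map (fun k => C m k * bernoulli k * x ^ (m - k)) (seq 0 (S m))).

(* Main.v *)
(** Expanding the product [G(j)] over the divisor tuples and using that [d_i^a | j] for
    every [i] means [M^a | j], each sum [sum_j h(j) G(j)] becomes a sum over the tuples of
    [F] times [h] summed over the multiples of [M^a]; with [N = L^a = K^a / M^a] these are
    - [sum_{i<=N} log Gamma(i/N)]: multiplying Gauss's products leaves [(N(n+1))!] against
      [n!^N], and Stirling's formula (Wallis' integrals give its constant) yields the limit;
    - [sum_i C(N D, i D)] with [D = M^a], by the roots of unity filter in its real form;
    - [sum_{i<N} B_m(i/N)], Raabe's multiplication formula at [0]. *)
From Coquelicot Require Import Rcomplements Rbar Hierarchy Continuity Lim_seq.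
From Coquelicot Require Import Derive RInt RInt_analysis AutoDerive.
Require Import Defs.
From Stdlib Require Import Reals Arith List ZArith Lra Lia.
Import ListNotations.
Open Scope R_scope.

(** * Expansion over divisor tuples *)

(** All three sums have the shape of a real weight [h j] against the same complex [G j], so one
    exchange of summation makes the coefficient of each [F] a real sum, and each identity is then
    checked tuple by tuple. For log Gamma the sum is (N-1)/2 log(2 pi) - (1/2) log N; substituting N
    = K^a/M^a splits it into the three terms of the statement, with log M appearing because log N =
    log K^a - a log M. [Gamma] is only a choice of limit of Gauss's products, so it says nothing
    until those converge. The arguments i/N lie in (0,1], and there the sequence increases and is
    bounded by Bernoulli's inequality; the limit must also be positive, since its logarithm is
    taken. Raabe's formula is obtained without generating functions: the difference of its two sides
    satisfies the derivative rule of an Appell sequence, and a periodicity kills the constants of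
    integration. *)

Ltac Cring := intros; repeat match goal with z : Cplx |- _ => destruct z end;
  unfold Cadd, Cmul, Cscale, Czero, Cone; simpl; f_equal; ring.

Lemma Cadd_0_l z : Cadd Czero z = z. Proof. Cring. Qed.
Lemma Cadd_assoc x y z : Cadd x (Cadd y z) = Cadd (Cadd x y) z. Proof. Cring. Qed.
Lemma Cmul_0_l z : Cmul Czero z = Czero. Proof. Cring. Qed.
Lemma Cmul_0_r z : Cmul z Czero = Czero. Proof. Cring. Qed.
Lemma Cmul_add_l x y z : Cmul (Cadd x y) z = Cadd (Cmul x z) (Cmul y z).
Proof. Cring. Qed.
Lemma Cmul_add_r x y z : Cmul z (Cadd x y) = Cadd (Cmul z x) (Cmul z y).
Proof. Cring. Qed.
Lemma Cscale_0_l z : Cscale 0 z = Czero. Proof. Cring. Qed.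
Lemma Cscale_0_r r : Cscale r Czero = Czero. Proof. Cring. Qed.
Lemma Cscale_add_l r s z : Cscale (r + s) z = Cadd (Cscale r z) (Cscale s z).
Proof. Cring. Qed.
Lemma Cscale_add_r r y z : Cscale r (Cadd y z) = Cadd (Cscale r y) (Cscale r z).
Proof. Cring. Qed.
Lemma Cscale_mul r s z : Cscale r (Cscale s z) = Cscale (r * s) z.
Proof. Cring. Qed.

Lemma Csum_app l l' : Csum (l ++ l') = Cadd (Csum l) (Csum l').
Proof.
  induction l as [|z l IH]; simpl.
  - now rewrite Cadd_0_l.
  - now rewrite IH, Cadd_assoc.
Qed.

Lemma Csum_flat_map {A B} (u : A -> list B) (w : B -> Cplx) l :
  Csum (map w (flat_map u l)) = Csum (map (fun x => Csum (map w (u x))) l).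
Proof.
  induction l as [|x l IH]; simpl; [reflexivity|].
  now rewrite map_app, Csum_app, IH.
Qed.

Lemma Csum_mul_l {A} (w : A -> Cplx) z l :
  Csum (map (fun x => Cmul z (w x)) l) = Cmul z (Csum (map w l)).
Proof.
  induction l as [|x l IH]; simpl.
  - now rewrite Cmul_0_r.
  - now rewrite IH, Cmul_add_r.
Qed.

Lemma Csum_mul_r {A} (w : A -> Cplx) z l :
  Csum (map (fun x => Cmul (w x) z) l) = Cmul (Csum (map w l)) z.
Proof.
  induction l as [|x l IH]; simpl.
  - now rewrite Cmul_0_l.
  - now rewrite IH, Cmul_add_l.
Qed.

Lemma Csum_scale {A} (w : A -> Cplx) r l :
  Csum (map (fun x => Cscale r (w x)) l) = Cscale r (Csum (map w l)).
Proof.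
  induction l as [|x l IH]; simpl.
  - now rewrite Cscale_0_r.
  - now rewrite IH, Cscale_add_r.
Qed.

Lemma Csum_add {A} (v w : A -> Cplx) l :
  Csum (map (fun x => Cadd (v x) (w x)) l)
  = Cadd (Csum (map v l)) (Csum (map w l)).
Proof.
  induction l as [|x l IH]; simpl.
  - now rewrite Cadd_0_l.
  - rewrite IH. Cring.
Qed.

Lemma Csum_filter {A} (p : A -> bool) (w : A -> Cplx) l :
  Csum (map w (filter p l)) = Csum (map (fun x => if p x then w x else Czero) l).
Proof.
  induction l as [|x l IH]; simpl; [reflexivity|].
  destruct (p x); simpl; rewrite IH; [reflexivity|now rewrite Cadd_0_l].
Qed.

(** * Divisibility and powers of least common multiples *)

Lemma ndvd_iff d m : ndvd d m = true <-> Nat.divide d m.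
Proof.
  unfold ndvd. rewrite Nat.eqb_eq. destruct d as [|d].
  - simpl. split; [intros ->; exists 0%nat; lia | intros [q Hq]; lia].
  - rewrite Nat.Lcm0.mod_divide. reflexivity.
Qed.

Lemma in_divisors d k : In d (divisors k) -> (0 < d)%nat /\ Nat.divide d k.
Proof.
  unfold divisors. rewrite filter_In, in_seq, ndvd_iff. intuition lia.
Qed.

(** A common divisor of x and y * y^a divides x, hence is coprime to y; Gauss's lemma moves it into
    y^a, where the induction hypothesis applies. *)
Lemma coprime_pow_r x y a : Nat.gcd x y = 1%nat -> Nat.gcd x (y ^ a) = 1%nat.
Proof.
  intros H; induction a as [|a IH]; apply Nat.divide_1_r; [apply Nat.gcd_divide_r|].
  pose proof (Nat.gcd_divide_l x (y ^ S a)) as Hl.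
  pose proof (Nat.gcd_divide_r x (y ^ S a)) as Hr.
  set (d := Nat.gcd x (y ^ S a)) in *. rewrite <- IH.
  apply Nat.gcd_greatest; [exact Hl|].
  apply (Nat.gauss d y); [exact Hr|]. apply Nat.divide_1_r. rewrite <- H.
  apply Nat.gcd_greatest; [|apply Nat.gcd_divide_r].
  exact (Nat.divide_trans _ _ _ (Nat.gcd_divide_l d y) Hl).
Qed.

Lemma coprime_pow x y a : Nat.gcd x y = 1%nat -> Nat.gcd (x ^ a) (y ^ a) = 1%nat.
Proof.
  intros H. apply coprime_pow_r. rewrite Nat.gcd_comm. apply coprime_pow_r.
  now rewrite Nat.gcd_comm.
Qed.

Lemma pow_divide x y a : Nat.divide x y -> Nat.divide (x ^ a) (y ^ a).
Proof. intros [q ->]. exists (q ^ a)%nat. apply Nat.pow_mul_l. Qed.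

(** With g = gcd(x,y), x = x' g and y = y' g, the lcm is x' y' g. Since x'^a and y'^a are coprime,
    Gauss's lemma combines the two divisibilities after cancelling g^a. *)
Lemma lcm_pow_divide x y a m : (0 < x)%nat ->
  Nat.divide (Nat.lcm x y ^ a) m <-> Nat.divide (x ^ a) m /\ Nat.divide (y ^ a) m.
Proof.
  intros Hx. split.
  - intros H; split; eapply Nat.divide_trans; try apply H; apply pow_divide.
    + apply Nat.divide_lcm_l.
    + apply Nat.divide_lcm_r.
  - set (g := Nat.gcd x y).
    assert (Hg : g <> 0%nat) by (intros E; apply Nat.gcd_eq_0_l in E; lia).
    destruct (Nat.gcd_divide_l x y) as [x' Ex], (Nat.gcd_divide_r x y) as [y' Ey].
    fold g in Ex, Ey.
    assert (Hc : Nat.gcd x' y' = 1%nat).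
    { apply (Nat.mul_cancel_r _ _ g Hg).
      rewrite <- Nat.gcd_mul_mono_r, <- Ex, <- Ey. fold g. lia. }
    assert (El : Nat.lcm x y = (x' * y' * g)%nat).
    { unfold Nat.lcm. fold g. rewrite Ey at 1. rewrite Nat.div_mul by exact Hg.
      rewrite Ex at 1. lia. }
    rewrite El, Ex, Ey, !Nat.pow_mul_l.
    intros [[q Hq] H2]. subst m.
    rewrite Nat.mul_assoc in H2 |- *.
    assert (Hga : (g ^ a)%nat <> 0%nat) by now apply Nat.pow_nonzero.
    apply Nat.mul_divide_mono_r. apply Nat.mul_divide_cancel_r in H2; [|exact Hga].
    rewrite Nat.mul_comm in H2. apply Nat.gauss in H2.
    + destruct H2 as [s ->]. exists s. lia.
    + apply coprime_pow. now rewrite Nat.gcd_comm.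
Qed.

Lemma lcm_list_pos l : (forall x, In x l -> (0 < x)%nat) -> (0 < lcm_list l)%nat.
Proof.
  induction l as [|x l IH]; intros H; simpl; [lia|].
  assert (Hx : (0 < x)%nat) by (apply H; now left).
  assert (Hl : (0 < lcm_list l)%nat) by (apply IH; intros; apply H; now right).
  fold (lcm_list l).
  destruct (Nat.eq_dec (Nat.lcm x (lcm_list l)) 0) as [E|E]; [|lia].
  apply Nat.lcm_eq_0 in E. lia.
Qed.

Lemma lcm_list_divide (t k : nat -> nat) idx :
  (forall i, In i idx -> Nat.divide (t i) (k i)) ->
  Nat.divide (lcm_list (map t idx)) (lcm_list (map k idx)).
Proof.
  induction idx as [|i idx IH]; intros H; simpl; [apply Nat.divide_refl|].
  apply Nat.lcm_least.
  - eapply Nat.divide_trans; [apply H; now left|apply Nat.divide_lcm_l].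
  - eapply Nat.divide_trans; [|apply Nat.divide_lcm_r].
    apply IH. intros; apply H; now right.
Qed.

Lemma in_div_tuples k idx t : In t (div_tuples k idx) ->
  forall i, In i idx -> In (t i) (divisors (k i)).
Proof.
  revert t; induction idx as [|i idx IH]; intros t; simpl; [easy|].
  rewrite in_flat_map. intros [d [Hd Ht]]. rewrite in_map_iff in Ht.
  destruct Ht as [t' [<- Ht']]. intros j Hj.
  destruct (Nat.eqb_spec j i) as [->|Hne]; [exact Hd|].
  apply IH; [exact Ht'|]. destruct Hj as [->|Hj]; [easy|exact Hj].
Qed.

(** Distributivity. [NoDup] guarantees that overriding a tuple at [i] leaves the entries read by the
    remaining factors unchanged. *)
Lemma Cprod_Csum_divisors (k : nat -> nat) (w : nat -> nat -> Cplx) idx :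
  NoDup idx ->
  Cprod (map (fun i => Csum (map (w i) (divisors (k i)))) idx)
  = Csum (map (fun t => Cprod (map (fun i => w i (t i)) idx)) (div_tuples k idx)).
Proof.
  induction idx as [|i idx IH]; intros Hnd; simpl; [Cring|].
  apply NoDup_cons_iff in Hnd. destruct Hnd as [Hi Hnd].
  rewrite Csum_flat_map. fold (Cprod (map (fun i => Csum (map (w i) (divisors (k i)))) idx)).
  rewrite IH, <- Csum_mul_r by exact Hnd. f_equal. apply map_ext. intros d.
  rewrite map_map, <- Csum_mul_l. f_equal. apply map_ext. intros t.
  rewrite Nat.eqb_refl. unfold Cprod. f_equal. f_equal. apply map_ext_in. intros j Hj.
  destruct (Nat.eqb_spec j i) as [->|_]; easy.
Qed.

Lemma Cprod_if_divides a m (t : nat -> nat) (w : nat -> Cplx) idx :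
  (forall i, In i idx -> (0 < t i)%nat) ->
  Cprod (map (fun i => if ndvd (t i ^ a) m then w i else Czero) idx)
  = if ndvd (lcm_list (map t idx) ^ a) m then Cprod (map w idx) else Czero.
Proof.
  induction idx as [|i idx IH]; intros Ht; simpl.
  - rewrite Nat.pow_1_l. unfold ndvd. now rewrite Nat.mod_1_r.
  - fold (Cprod (map (fun i => if ndvd (t i ^ a) m then w i else Czero) idx)).
    rewrite IH by (intros; apply Ht; now right).
    assert (Hi : (0 < t i)%nat) by (apply Ht; now left).
    fold (lcm_list (map t idx)).
    pose proof (lcm_pow_divide (t i) (lcm_list (map t idx)) a m Hi) as H.
    rewrite <- !ndvd_iff in H.
    destruct (ndvd (t i ^ a) m), (ndvd (lcm_list (map t idx) ^ a) m),
      (ndvd (Nat.lcm (t i) (lcm_list (map t idx)) ^ a) m);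
      try reflexivity; rewrite ?Cmul_0_l, ?Cmul_0_r; intuition congruence.
Qed.

Lemma Cprod_s_a a (f g : nat -> arith) k idx m : NoDup idx ->
  Cprod (map (fun i => s_a a (f i) (g i) (k i) m) idx)
  = Csum (map (fun t => if ndvd (lcm_list (map t idx) ^ a) m
      then Cprod (map (fun i => Cmul (f i (t i)) (g i (k i / t i)%nat)) idx)
      else Czero) (div_tuples k idx)).
Proof.
  intros Hnd. unfold s_a.
  rewrite (map_ext _ _ (fun i => Csum_filter _ _ _)).
  rewrite (Cprod_Csum_divisors k (fun i d => if ndvd (d ^ a) m then
    Cmul (f i d) (g i (k i / d)%nat) else Czero) idx Hnd).
  f_equal. apply map_ext_in. intros t Ht.
  apply (Cprod_if_divides a m t (fun i => Cmul (f i (t i)) (g i (k i / t i)%nat))).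
  intros i Hi. now apply (in_div_tuples _ _ _ Ht), in_divisors in Hi.
Qed.

Lemma Csum_exchange {A B} (h : A -> R) (p : A -> B -> bool) (F : B -> Cplx)
    (l : list A) (T : list B) :
  Csum (map (fun x => Cscale (h x)
    (Csum (map (fun t => if p x t then F t else Czero) T))) l)
  = Csum (map (fun t => Cscale
      (Rsum (map (fun x => if p x t then h x else 0) l)) (F t)) T).
Proof.
  induction l as [|x l IH]; simpl.
  - induction T as [|t T IHT]; simpl; [reflexivity|].
    now rewrite <- IHT, Cscale_0_l, Cadd_0_l.
  - rewrite IH, <- Csum_scale, <- Csum_add. f_equal. apply map_ext. intros t.
    destruct (p x t); Cring.
Qed.

(** * Finite real sums and sums over multiples *)

Lemma Rsum_app l l' : Rsum (l ++ l') = Rsum l + Rsum l'.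
Proof. induction l as [|x l IH]; simpl; [ring|]. rewrite IH. ring. Qed.

Lemma Rsum_map_add {A} (u v : A -> R) l :
  Rsum (map (fun x => u x + v x) l) = Rsum (map u l) + Rsum (map v l).
Proof. induction l as [|x l IH]; simpl; [ring|]. rewrite IH. ring. Qed.

Lemma Rsum_map_mul {A} (u : A -> R) c l :
  Rsum (map (fun x => c * u x) l) = c * Rsum (map u l).
Proof. induction l as [|x l IH]; simpl; [ring|]. rewrite IH. ring. Qed.

Lemma Rsum_exchange {A B} (u : A -> B -> R) l l' :
  Rsum (map (fun x => Rsum (map (u x) l')) l)
  = Rsum (map (fun y => Rsum (map (fun x => u x y) l)) l').
Proof.
  induction l as [|x l IH]; simpl.
  - induction l' as [|y l' IH]; simpl; [ring|]. rewrite <- IH. ring.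
  - now rewrite IH, <- Rsum_map_add.
Qed.

Lemma Rsum_seq_S (u : nat -> R) s n :
  Rsum (map u (seq s (S n))) = Rsum (map u (seq s n)) + u (s + n)%nat.
Proof. rewrite seq_S, map_app, Rsum_app. simpl. ring. Qed.

Lemma Rsum_seq_shift (u : nat -> R) s n :
  Rsum (map u (seq (S s) n)) = Rsum (map (fun j => u (S j)) (seq s n)).
Proof. now rewrite <- seq_shift, map_map. Qed.

Lemma ndvd_between D q r : (0 < r < D)%nat -> ndvd D (q * D + r) = false.
Proof.
  intros H. apply Bool.not_true_iff_false. rewrite ndvd_iff. intros [s Hs].
  destruct (Nat.le_gt_cases s q); nia.
Qed.

Lemma Rsum_multiples_lt (h : nat -> R) D N : (0 < D)%nat ->
  Rsum (map (fun j => if ndvd D j then h j else 0) (seq 0 (N * D)))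
  = Rsum (map (fun i => h (i * D)%nat) (seq 0 N)).
Proof.
  intros HD. induction N as [|N IH]; [reflexivity|].
  replace (S N * D)%nat with (N * D + D)%nat by lia.
  rewrite seq_app, map_app, Rsum_app, IH, Rsum_seq_S. f_equal.
  destruct D as [|D]; [lia|]. simpl (0 + _)%nat.
  rewrite <- cons_seq. simpl.
  assert (E : ndvd (S D) (N * S D) = true) by (apply ndvd_iff; now exists N).
  rewrite E.
  (* Only the first index of a block of length D is a multiple of D. The zero is written as a
     product so that [Rsum_map_mul] pulls it out. *)
  rewrite (map_ext_in _ (fun _ => 0 * 0)).
  - rewrite Rsum_map_mul. ring.
  - intros j Hj. apply in_seq in Hj.
    replace j with (N * S D + (j - N * S D))%nat by lia.
    rewrite ndvd_between by lia. ring.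
Qed.

Lemma Rsum_multiples_le (h : nat -> R) D N : (0 < D)%nat ->
  Rsum (map (fun j => if ndvd D j then h j else 0) (seq 1 (N * D)))
  = Rsum (map (fun i => h (i * D)%nat) (seq 1 N)).
Proof.
  intros HD. pose proof (Rsum_multiples_lt h D N HD) as H.
  (* Adding the term at 0 makes both ranges start at 0; they then exceed those of
     [Rsum_multiples_lt] by their last term only. *)
  apply (Rplus_eq_reg_l (h 0%nat)).
  transitivity (Rsum (map (fun i => h (i * D)%nat) (seq 0 (S N)))); [|reflexivity].
  rewrite Rsum_seq_S, <- H. simpl (0 + _)%nat.
  assert (E : forall j, Nat.divide D j -> ndvd D j = true) by (intros; now apply ndvd_iff).
  transitivity (Rsum (map (fun j => if ndvd D j then h j else 0) (seq 0 (S (N * D))))).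
  - rewrite <- cons_seq. simpl. rewrite E; [reflexivity|now exists 0%nat].
  - rewrite Rsum_seq_S. simpl (0 + _)%nat. rewrite (E (N * D)%nat); [reflexivity|now exists N].
Qed.

(** * Binomial coefficients along an arithmetic progression *)

Lemma C_0_r n : C n 0 = 1.
Proof.
  unfold C. rewrite Nat.sub_0_r. simpl (INR (fact 0)). field. apply INR_fact_neq_0.
Qed.

Lemma C_diag n : C n n = 1.
Proof.
  unfold C. rewrite Nat.sub_diag. simpl (INR (fact 0)). field. apply INR_fact_neq_0.
Qed.

Lemma Rsum_C_succ (n : nat) (u : nat -> R) :
  Rsum (map (fun j => C (S n) j * u j) (seq 0 (S (S n))))
  = Rsum (map (fun j => C n j * u j) (seq 0 (S n)))
    + Rsum (map (fun j => C n j * u (S j)) (seq 0 (S n))).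
Proof.
  assert (E : forall p (v : nat -> R),
    Rsum (map v (seq 0 (S p))) = v 0%nat + Rsum (map (fun j => v (S j)) (seq 0 p)))
    by (intros; simpl; now rewrite Rsum_seq_shift).
  rewrite E, Rsum_seq_S, (E n), (Rsum_seq_S _ 0 n), !C_0_r. simpl (0 + n)%nat.
  rewrite !C_diag.
  rewrite (map_ext_in _ (fun j => C n (S j) * u (S j) + C n j * u (S j))).
  - rewrite Rsum_map_add. ring.
  - intros j Hj. apply in_seq in Hj. rewrite <- pascal by lia. ring.
Qed.

(** Real part of e^(i phi) (1 + e^(2 i th))^n = e^(i phi) (2 cos th)^n e^(i n th). The phase [phi]
    is free because Pascal's rule shifts it by 2 th in the induction. *)
Lemma binomial_cos_sum (n : nat) th phi :
  Rsum (map (fun j => C n j * cos (INR j * (2 * th) + phi)) (seq 0 (S n)))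
  = 2 ^ n * cos th ^ n * cos (INR n * th + phi).
Proof.
  revert phi; induction n as [|n IH]; intros phi.
  - simpl. rewrite C_0_r. ring_simplify. f_equal; ring.
  - rewrite Rsum_C_succ, IH.
    rewrite (map_ext _ (fun j => C n j * cos (INR j * (2 * th) + (2 * th + phi)))).
    + rewrite IH, <- tech_pow_Rmult, <- tech_pow_Rmult, S_INR.
      replace (INR n * th + phi) with ((INR n + 1) * th + phi - th) by ring.
      replace (INR n * th + (2 * th + phi)) with ((INR n + 1) * th + phi + th) by ring.
      rewrite cos_plus, cos_minus. ring.
    + intros j. rewrite S_INR. do 2 f_equal. ring.
Qed.

(** Each term 2 sin(al/2) cos(l al) is sin((l + 1/2) al) - sin((l - 1/2) al). *)
Lemma cos_sum_telescope (D : nat) al :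
  2 * sin (al / 2) * Rsum (map (fun l => cos (INR l * al)) (seq 1 D))
  = sin (INR D * al + al / 2) - sin (al / 2).
Proof.
  induction D as [|D IH].
  - simpl. rewrite Rmult_0_l, Rplus_0_l. ring.
  - rewrite Rsum_seq_S, Rmult_plus_distr_l, IH. change (1 + D)%nat with (S D).
    replace (INR D * al + al / 2) with (INR (S D) * al - al / 2)
      by (rewrite S_INR; field).
    rewrite sin_plus, sin_minus. ring.
Qed.

Lemma cos_2PI_nat q : cos (INR q * (2 * PI)) = 1.
Proof.
  replace (INR q * (2 * PI)) with (0 + 2 * INR q * PI) by ring.
  now rewrite cos_period, cos_0.
Qed.

Lemma Rsum_const {A} (c : R) (l : list A) : Rsum (map (fun _ => c) l) = INR (length l) * c.
Proof.
  induction l as [|x l IH]; [simpl; ring|].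
  change (length (x :: l)) with (S (length l)). rewrite S_INR. simpl. rewrite IH. ring.
Qed.

(** Real form of the sum of the D-th roots of unity raised to the power j. If D does not divide j,
    then sin(pi j/D) is nonzero, while the telescoped sum vanishes because D al = 2 pi j. *)
Lemma cos_sum_filter D j : (0 < D)%nat ->
  Rsum (map (fun l => cos (INR l * (2 * (PI * INR j / INR D)))) (seq 1 D))
  = if ndvd D j then INR D else 0.
Proof.
  intros HD. assert (HD' : INR D <> 0) by (apply not_0_INR; lia).
  destruct (ndvd D j) eqn:E.
  - apply ndvd_iff in E. destruct E as [q ->].
    rewrite (map_ext _ (fun _ => 1)).
    + rewrite Rsum_const, length_seq. ring.
    + intros l. rewrite <- (cos_2PI_nat (l * q)). f_equal.
      rewrite !mult_INR. now field.
  - set (al := 2 * (PI * INR j / INR D)).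
    assert (Hs : sin (al / 2) <> 0).
    { intros H. replace (al / 2) with (PI * INR j / INR D) in H by (unfold al; now field).
      apply sin_eq_0_0 in H. destruct H as [z Hz].
      assert (Hz' : IZR (Z.of_nat j) = IZR (z * Z.of_nat D)).
      { rewrite mult_IZR, <- !INR_IZR_INZ.
        apply (Rmult_eq_reg_l PI); [|apply PI_neq0].
        apply (Rmult_eq_reg_r (/ INR D)); [|now apply Rinv_neq_0_compat].
        transitivity (IZR z * PI); [exact Hz|now field]. }
      apply eq_IZR in Hz'. apply Bool.not_true_iff_false in E. apply E, ndvd_iff.
      exists (Z.to_nat z). nia. }
    pose proof (cos_sum_telescope D al) as H.
    replace (INR D * al + al / 2) with (al / 2 + 2 * INR j * PI) in H
      by (unfold al; now field).
    rewrite sin_period, Rminus_diag in H.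
    apply Rmult_integral in H. lra.
Qed.

Lemma cos_nat_PI q : cos (INR q * PI) = (-1) ^ q.
Proof.
  induction q as [|q IH]; [simpl; rewrite Rmult_0_l; apply cos_0|].
  rewrite S_INR, Rmult_plus_distr_r, Rmult_1_l, neg_cos, IH. simpl. ring.
Qed.

Lemma binomial_multiples_sum D N : (0 < D)%nat ->
  Rsum (map (fun j => if ndvd D j then C (N * D) j else 0) (seq 0 (S (N * D))))
  = 2 ^ (N * D) * (/ INR D *
      Rsum (map (fun l => (-1) ^ (l * N) * cos (PI * INR l / INR D) ^ (N * D)) (seq 1 D))).
Proof.
  intros HD. assert (HD' : INR D <> 0) by (apply not_0_INR; lia).
  apply (Rmult_eq_reg_l (INR D)); [|exact HD'].
  rewrite <- Rsum_map_mul.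
  (* D times the indicator of D | j is replaced by the cosine sum. After the exchange, the
     half-angle pi l/D taken N D times is l N pi, whence the sign (-1)^(l N). *)
  rewrite (map_ext _ (fun j => Rsum (map (fun l =>
    C (N * D) j * cos (INR l * (2 * (PI * INR j / INR D)))) (seq 1 D)))).
  - rewrite Rsum_exchange.
    transitivity (2 ^ (N * D) * Rsum (map (fun l => (-1) ^ (l * N) *
      cos (PI * INR l / INR D) ^ (N * D)) (seq 1 D))); [|now field].
    rewrite <- Rsum_map_mul. f_equal. apply map_ext. intros l.
    rewrite (map_ext _ (fun j => C (N * D) j * cos (INR j * (2 * (PI * INR l / INR D)) + 0))).
    + rewrite binomial_cos_sum, <- cos_nat_PI.
      replace (INR (N * D) * (PI * INR l / INR D) + 0) with (INR (l * N) * PI)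
        by (rewrite !mult_INR; now field).
      ring.
    + intros j. do 2 f_equal. now field.
  - intros j. rewrite Rsum_map_mul, cos_sum_filter by exact HD.
    destruct (ndvd D j); ring.
Qed.

(** * Multiplication formula for Bernoulli polynomials *)

Lemma bern_list_length m : length (bern_list m) = S m.
Proof. induction m as [|m IH]; [reflexivity|]. simpl. rewrite length_app, IH. simpl. lia. Qed.

Lemma nth_bern_list j m : (j <= m)%nat -> nth j (bern_list m) 0 = bernoulli j.
Proof.
  induction m as [|m IH]; intros H.
  - now replace j with 0%nat by lia.
  - destruct (Nat.eq_dec j (S m)) as [->|Hne]; [reflexivity|].
    simpl. rewrite app_nth1 by (rewrite bern_list_length; lia). apply IH. lia.
Qed.

(** The last coefficient C(p+2, p+1) = p+2 is the denominator in [bern_list], so the newest entry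
    cancels all earlier terms. *)
Lemma bernoulli_succ p :
  Rsum (map (fun j => C (S (S p)) j * bernoulli j) (seq 0 (S (S p)))) = 0.
Proof.
  rewrite Rsum_seq_S. simpl (0 + _)%nat.
  assert (E : bernoulli (S p) = - Rsum (map (fun j => C (S (S p)) j * bernoulli j)
    (seq 0 (S p))) / INR (S (S p))).
  { unfold bernoulli at 1. cbn [bern_list].
    rewrite app_nth2, bern_list_length, Nat.sub_diag by (rewrite bern_list_length; lia).
    cbn [nth]. do 3 f_equal. apply map_ext_in. intros j Hj. apply in_seq in Hj.
    rewrite nth_bern_list by lia. reflexivity. }
  rewrite E. replace (C (S (S p)) (S p)) with (INR (S (S p))).
  - field. apply not_0_INR. lia.
  - rewrite pascal_step1 by lia. replace (S (S p) - S p)%nat with 1%nat by lia.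
    rewrite pascal_step3, C_0_r by lia. simpl (INR 1). rewrite Nat.sub_0_r. field.
Qed.

Lemma bernpoly_0 m : bernpoly m 0 = bernoulli m.
Proof.
  unfold bernpoly. rewrite Rsum_seq_S. simpl (0 + _)%nat.
  rewrite (map_ext_in _ (fun _ => 0)).
  - rewrite Rsum_const, Nat.sub_diag, C_diag. simpl. ring.
  - intros j Hj. apply in_seq in Hj. rewrite pow_i by lia. ring.
Qed.

(** At 1 every term but the last is absorbed by [bernoulli_succ]. The order starts at 2 since B_1(1)
    = 1/2 differs from B_1(0) = -1/2. *)
Lemma bernpoly_1 p : bernpoly (S (S p)) 1 = bernpoly (S (S p)) 0.
Proof.
  rewrite bernpoly_0. unfold bernpoly. rewrite Rsum_seq_S. simpl (0 + _)%nat.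
  rewrite (map_ext _ (fun j => C (S (S p)) j * bernoulli j))
    by (intros; rewrite pow1; ring).
  rewrite bernoulli_succ, C_diag, pow1. ring.
Qed.

Lemma is_derive_Rsum {A} (u du : A -> R -> R) (l : list A) x :
  (forall i, In i l -> is_derive (u i) x (du i x)) ->
  is_derive (fun y => Rsum (map (fun i => u i y) l)) x (Rsum (map (fun i => du i x) l)).
Proof.
  induction l as [|i l IH]; intros H; simpl.
  - apply @is_derive_const.
  - apply @is_derive_plus; [apply H; now left|].
    apply IH. intros; apply H; now right.
Qed.

Lemma C_succ_mul m j : (j <= m)%nat -> C (S m) j * INR (S m - j) = INR (S m) * C m j.
Proof.
  intros H. rewrite pascal_step2 by exact H. field. apply not_0_INR. lia.
Qed.

(** The Appell property: [C_succ_mul] converts the termwise derivatives, and the constant term j =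
    m+1 drops out. *)
Lemma is_derive_bernpoly m x :
  is_derive (bernpoly (S m)) x (INR (S m) * bernpoly m x).
Proof.
  unfold bernpoly.
  replace (INR (S m) * _) with (Rsum (map (fun j => C (S m) j * bernoulli j *
    (INR (S m - j) * x ^ pred (S m - j))) (seq 0 (S (S m))))).
  - apply (is_derive_Rsum (fun j y => C (S m) j * bernoulli j * y ^ (S m - j))
      (fun j y => C (S m) j * bernoulli j * (INR (S m - j) * y ^ pred (S m - j)))).
    intros j _. generalize (S m - j)%nat. intros p. auto_derive; [exact I|ring].
  - rewrite Rsum_seq_S. simpl (0 + _)%nat. rewrite Nat.sub_diag, <- Rsum_map_mul.
    simpl (INR 0). rewrite Rmult_0_l, Rmult_0_r, Rplus_0_r.
    f_equal. apply map_ext_in. intros j Hj. apply in_seq in Hj.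
    replace (pred (S m - j)) with (m - j)%nat by lia.
    transitivity (C (S m) j * INR (S m - j) * bernoulli j * x ^ (m - j)); [ring|].
    rewrite C_succ_mul by lia. ring.
Qed.

Lemma is_derive_const_slope (f : R -> R) c x y :
  (forall z, is_derive f z c) -> f y - f x = c * (y - x).
Proof.
  intros H. destruct (MVT_gen f x y (fun _ => c)) as [z [_ Hz]].
  - intros; apply H.
  - intros z _. apply derivable_continuous_pt. exists c. apply is_derive_Reals, H.
  - exact Hz.
Qed.

(* [N^m] is carried on the left so that no negative power occurs at [m = 0]. *)
Definition bern_defect (N m : nat) (x : R) : R :=
  INR N ^ m * Rsum (map (fun i => bernpoly m (x + INR i / INR N)) (seq 0 N))
  - INR N * bernpoly m (INR N * x).

(** The chain rule on B_(m+1)(N x) yields a factor N, which matches the extra factor in N^(m+1), so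
    the defects reproduce themselves. *)
Lemma is_derive_bern_defect N m x :
  is_derive (bern_defect N (S m)) x (INR (S m) * INR N * bern_defect N m x).
Proof.
  unfold bern_defect.
  replace (INR (S m) * INR N * _) with
    (minus (scal (INR N ^ S m) (Rsum (map (fun i => INR (S m) * bernpoly m (x + INR i / INR N))
        (seq 0 N))))
     (scal (INR N) (INR N * (INR (S m) * bernpoly m (INR N * x))))).
  - apply @is_derive_minus; apply @is_derive_scal.
    + apply (is_derive_Rsum (fun i y => bernpoly (S m) (y + INR i / INR N))
        (fun i y => INR (S m) * bernpoly m (y + INR i / INR N))).
      intros i _.
      replace (INR (S m) * _) with (scal 1 (INR (S m) * bernpoly m (x + INR i / INR N)))
        by (apply Rmult_1_l).
      apply (is_derive_comp (bernpoly (S m)) (fun y => y + INR i / INR N)).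
      * apply is_derive_bernpoly.
      * auto_derive; [exact I|ring].
    + apply (is_derive_comp (bernpoly (S m)) (fun y => INR N * y)).
      * apply is_derive_bernpoly.
      * auto_derive; [exact I|ring].
  - rewrite Rsum_map_mul. unfold minus, plus, opp, scal; simpl. unfold mult; simpl. ring.
Qed.

(** Shifting by 1/N permutes the nodes i/N cyclically, except that 1 replaces 0; [bernpoly_1]
    identifies these two values, and likewise the two values of N x. *)
Lemma bern_defect_period N p : (0 < N)%nat ->
  bern_defect N (S (S p)) (1 / INR N) = bern_defect N (S (S p)) 0.
Proof.
  intros HN. assert (HN' : INR N <> 0) by (apply not_0_INR; lia).
  unfold bern_defect. replace (INR N * (1 / INR N)) with 1 by now field.
  rewrite Rmult_0_r, bernpoly_1. do 2 f_equal.
  set (u := fun i => bernpoly (S (S p)) (INR i / INR N)).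
  transitivity (Rsum (map u (seq 1 N))).
  - rewrite Rsum_seq_shift. f_equal. apply map_ext. intros i. unfold u.
    rewrite S_INR. f_equal. now field.
  - transitivity (Rsum (map u (seq 0 N))).
    + apply (Rplus_eq_reg_l (u 0%nat)).
      change (Rsum (map u (seq 0 (S N))) = u 0%nat + Rsum (map u (seq 0 N))).
      rewrite Rsum_seq_S. simpl (0 + _)%nat. unfold u at 2 3.
      replace (INR N / INR N) with 1 by now field.
      replace (INR 0 / INR N) with 0 by (simpl; now field).
      rewrite bernpoly_1. ring.
    + f_equal. apply map_ext. intros i. unfold u. f_equal. ring.
Qed.

(* If the defect vanishes at order [m] then it is constant at order [m + 1], hence
   affine at order [m + 2], where periodicity forces its slope to be zero. *)
Lemma bern_defect_zero N m x : (0 < N)%nat -> bern_defect N m x = 0.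
Proof.
  intros HN. assert (HN' : INR N <> 0) by (apply not_0_INR; lia).
  revert x; induction m as [|m IH]; intros x.
  - unfold bern_defect, bernpoly. simpl. rewrite Rsum_const, length_seq. ring.
  - assert (Hc : forall y, bern_defect N (S m) y = bern_defect N (S m) x).
    { intros y. apply Rminus_diag_uniq.
      rewrite (is_derive_const_slope _ 0); [ring|]. intros z.
      replace 0 with (INR (S m) * INR N * bern_defect N m z) by (rewrite IH; ring).
      apply is_derive_bern_defect. }
    pose proof (is_derive_const_slope (bern_defect N (S (S m)))
      (INR (S (S m)) * INR N * bern_defect N (S m) x) 0 (1 / INR N)) as H.
    rewrite bern_defect_period, Rminus_diag in H by exact HN.
    assert (H' : INR (S (S m)) * bern_defect N (S m) x = 0).
    { rewrite H at 1; [now field|]. intros z. rewrite <- (Hc z). apply is_derive_bern_defect. }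
    apply Rmult_integral in H'. destruct H' as [H'|H']; [|exact H'].
    exfalso; revert H'. apply not_0_INR. lia.
Qed.

Lemma bernpoly_mul_sum N m : (0 < N)%nat ->
  INR N ^ m * Rsum (map (fun i => bernpoly m (INR i / INR N)) (seq 0 N))
  = INR N * bernoulli m.
Proof.
  intros HN. pose proof (bern_defect_zero N m 0 HN) as H. unfold bern_defect in H.
  rewrite Rmult_0_r, bernpoly_0 in H. apply Rminus_diag_uniq in H. rewrite <- H.
  do 2 f_equal. apply map_ext. intros i. f_equal. ring.
Qed.

(** * Convergence of Gauss's product *)

Lemma exp_le_compat x y : x <= y -> exp x <= exp y.
Proof. intros [H| ->]; [now apply Rlt_le, exp_increasing|apply Rle_refl]. Qed.

(** Bernoulli's inequality for exponents in [0,1]; both monotonicity statements about Gauss's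
    products rest on it. *)
Lemma Rpower_bernoulli y x : 0 < y -> 0 <= x <= 1 -> Rpower y x <= 1 + x * (y - 1).
Proof.
  intros Hy Hx. set (c := 1 + x * (y - 1)).
  assert (Hc : 0 < c).
  { unfold c. destruct (Rle_lt_dec x (1 / 2)); nra. }
  assert (Hln : forall z, 0 < z -> ln z <= z - 1).
  { intros z Hz. pose proof (exp_ineq1_le (ln z)) as H. rewrite exp_ln in H by exact Hz. lra. }
  (* Tangent line of [ln] at [c], at the points [y] and [1] with weights [x] and [1 - x]. *)
  assert (H : x * ln y <= ln c).
  { pose proof (Hln (y / c) (Rdiv_lt_0_compat _ _ Hy Hc)) as H1.
    pose proof (Hln (/ c) (Rinv_0_lt_compat _ Hc)) as H2.
    rewrite ln_div in H1 by assumption. rewrite ln_Rinv in H2 by exact Hc.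
    assert (E : x * (y / c - 1) + (1 - x) * (/ c - 1) = 0) by (unfold c; field; fold c; lra).
    nra. }
  unfold Rpower. rewrite <- (exp_ln c Hc). now apply exp_le_compat.
Qed.

Lemma Rprod_app l l' : Rprod (l ++ l') = Rprod l * Rprod l'.
Proof. induction l as [|x l IH]; simpl; [ring|]. rewrite IH. ring. Qed.

Lemma Rprod_pos l : (forall x, In x l -> 0 < x) -> 0 < Rprod l.
Proof.
  induction l as [|x l IH]; intros H; simpl; [lra|].
  apply Rmult_lt_0_compat; [apply H; now left|].
  apply IH; intros; apply H; now right.
Qed.

Lemma gauss_den_pos x n : 0 < x -> 0 < Rprod (map (fun i => x + INR i) (seq 0 n)).
Proof.
  intros Hx. apply Rprod_pos. intros y Hy. apply in_map_iff in Hy.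
  destruct Hy as [i [<- _]]. pose proof (pos_INR i). lra.
Qed.

Lemma gauss_seq_pos x n : 0 < x -> 0 < gauss_seq x n.
Proof.
  intros Hx. apply Rdiv_lt_0_compat; [|now apply gauss_den_pos].
  apply Rmult_lt_0_compat; [apply INR_fact_lt_0|apply exp_pos].
Qed.

Lemma gauss_seq_succ x n : 0 < x ->
  gauss_seq x (S n) = gauss_seq x n *
    (INR (S n) / (x + INR (S n)) * (Rpower (INR (S n)) x / Rpower (INR n) x)).
Proof.
  intros Hx. unfold gauss_seq.
  rewrite (seq_S (S n) 0), map_app, Rprod_app, fact_simpl, mult_INR. simpl (0 + _)%nat.
  set (P := Rprod (map (fun i => x + INR i) (seq 0 (S n)))).
  assert (HP : 0 < P) by now apply gauss_den_pos.
  assert (0 < Rpower (INR n) x) by apply exp_pos.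
  assert (0 < INR (S n)) by (apply lt_0_INR; lia).
  cbn [map Rprod fold_right]. field. lra.
Qed.

Lemma Rpower_div a b x : 0 < a -> 0 < b -> Rpower a x / Rpower b x = Rpower (a / b) x.
Proof.
  intros Ha Hb. unfold Rpower. rewrite ln_div by assumption.
  unfold Rdiv. rewrite <- exp_Ropp, <- exp_plus. f_equal. ring.
Qed.

(** With s = n+1, Bernoulli's inequality at n/s gives (n/s)^x <= 1 - x/s, and (1 - x/s)(x + s) = s -
    x^2/s <= s, so the ratio of consecutive terms is at least 1. *)
Lemma gauss_seq_growing x n : 0 < x <= 1 -> (1 <= n)%nat ->
  gauss_seq x n <= gauss_seq x (S n).
Proof.
  intros Hx Hn. rewrite gauss_seq_succ by lra.
  assert (HN : 0 < INR n) by (apply lt_0_INR; lia).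
  rewrite <- (Rmult_1_r (gauss_seq x n)) at 1.
  apply Rmult_le_compat_l; [apply Rlt_le, gauss_seq_pos; lra|].
  pose proof (Rpower_bernoulli (INR n / INR (S n)) x) as H.
  assert (HS : 0 < INR (S n)) by (apply lt_0_INR; lia).
  rewrite <- Rpower_div in H by assumption.
  specialize (H (Rdiv_lt_0_compat _ _ HN HS) ltac:(lra)).
  assert (Hp : 0 < Rpower (INR n) x) by apply exp_pos.
  assert (Hq : 0 < Rpower (INR (S n)) x) by apply exp_pos.
  set (p := Rpower (INR n) x) in *. set (q := Rpower (INR (S n)) x) in *.
  set (s := INR (S n)) in *.
  replace (INR n / s - 1) with (- / s) in H
    by (unfold s; rewrite S_INR; field; rewrite <- S_INR; fold s; lra).
  apply (Rmult_le_reg_r (p * (x + s))); [apply Rmult_lt_0_compat; lra|].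
  replace (s / (x + s) * (q / p) * (p * (x + s))) with (s * q) by (field; lra).
  apply (Rmult_le_compat_r (q * (x + s))) in H; [|nra].
  replace (p / q * (q * (x + s))) with (p * (x + s)) in H by (field; lra).
  replace ((1 + x * - / s) * (q * (x + s))) with (s * q - q * (x * x) / s) in H by (field; lra).
  assert (0 <= q * (x * x) / s) by (apply Rmult_le_pos; [nra|now apply Rlt_le, Rinv_0_lt_compat]).
  lra.
Qed.

(** For n >= 1, Gauss's quotient with (n+1)^x in place of n^x: a decreasing companion that bounds
    the sequence from above. *)
Definition gauss_upper (x : R) (n : nat) : R :=
  gauss_seq x n * Rpower (INR (S n) / INR n) x.

Lemma gauss_upper_decreasing x n : 0 < x <= 1 -> (1 <= n)%nat ->
  gauss_upper x (S n) <= gauss_upper x n.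
Proof.
  intros Hx Hn. unfold gauss_upper. rewrite gauss_seq_succ by lra.
  assert (HN : 0 < INR n) by (apply lt_0_INR; lia).
  assert (HS : 0 < INR (S n)) by (apply lt_0_INR; lia).
  assert (HSS : 0 < INR (S (S n))) by (apply lt_0_INR; lia).
  rewrite Rpower_div by assumption. rewrite !Rmult_assoc.
  apply Rmult_le_compat_l; [apply Rlt_le, gauss_seq_pos; lra|].
  pose proof (Rpower_bernoulli (INR (S (S n)) / INR (S n)) x
    (Rdiv_lt_0_compat _ _ HSS HS) ltac:(lra)) as H.
  assert (Hp : 0 < Rpower (INR (S n) / INR n) x) by apply exp_pos.
  set (p := Rpower (INR (S n) / INR n) x) in *.
  set (q := Rpower (INR (S (S n)) / INR (S n)) x) in *.
  rewrite (S_INR (S n)) in H. set (s := INR (S n)) in *.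
  replace (1 + x * ((s + 1) / s - 1)) with ((x + s) / s) in H by (field; lra).
  apply (Rle_trans _ (s / (x + s) * (p * ((x + s) / s)))).
  - apply Rmult_le_compat_l.
    + apply Rlt_le, Rdiv_lt_0_compat; lra.
    + apply Rmult_le_compat_l; lra.
  - right. field. lra.
Qed.

Lemma gauss_seq_bounded x n : 0 < x <= 1 -> gauss_seq x (S n) <= gauss_upper x 1.
Proof.
  intros Hx. apply (Rle_trans _ (gauss_upper x (S n))).
  - unfold gauss_upper. rewrite <- (Rmult_1_r (gauss_seq x (S n))) at 1.
    apply Rmult_le_compat_l; [apply Rlt_le, gauss_seq_pos; lra|].
    assert (HS : 0 < INR (S n)) by (apply lt_0_INR; lia).
    unfold Rpower. rewrite <- exp_0. apply exp_le_compat. apply Rmult_le_pos; [lra|].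
    rewrite <- ln_1. apply ln_le; [lra|]. rewrite (S_INR (S n)).
    apply (Rmult_le_reg_r (INR (S n))); [exact HS|]. field_simplify; lra.
  - induction n as [|n IH]; [apply Rle_refl|].
    eapply Rle_trans; [apply gauss_upper_decreasing; [exact Hx|lia]|exact IH].
Qed.

Lemma gauss_seq_cv x : 0 < x <= 1 -> exists l, 0 < l /\ Un_cv (gauss_seq x) l.
Proof.
  intros Hx.
  (* The sequence is shifted by one because monotonicity starts at index 1; at index 0, [Rpower] is
     evaluated at 0, outside its meaningful domain. *)
  destruct (growing_cv (fun n => gauss_seq x (S n))) as [l Hl].
  - intros n. apply gauss_seq_growing; [exact Hx|lia].
  - exists (gauss_upper x 1). intros y [n ->]. now apply gauss_seq_bounded.
  - exists l. split.
    + apply (Rlt_le_trans _ (gauss_seq x 1)); [apply gauss_seq_pos; lra|].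
      apply (growing_ineq (fun n => gauss_seq x (S n)) l) with (n := 0%nat); [|exact Hl].
      intros n. apply gauss_seq_growing; [exact Hx|lia].
    + apply is_lim_seq_Reals, is_lim_seq_incr_1, is_lim_seq_Reals. exact Hl.
Qed.

(** Existence of a limit lets [epsilon] return one, and uniqueness of limits transfers the
    positivity to it. *)
Lemma Gamma_spec x : 0 < x <= 1 -> 0 < Gamma x /\ Un_cv (gauss_seq x) (Gamma x).
Proof.
  intros Hx. destruct (gauss_seq_cv x Hx) as [l [Hl Hcv]].
  assert (HG : Un_cv (gauss_seq x) (Gamma x))
    by (unfold Gamma; apply ClassicalEpsilon.epsilon_spec; now exists l).
  now rewrite (UL_sequence _ _ _ HG Hcv) in *.
Qed.

Lemma lnGamma_lim x : 0 < x <= 1 -> is_lim_seq (fun n => ln (gauss_seq x n)) (lnGamma x).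
Proof.
  intros Hx. destruct (Gamma_spec x Hx) as [Hp Hc].
  apply (is_lim_seq_continuous ln).
  - apply derivable_continuous_pt. exists (/ Gamma x). now apply derivable_pt_lim_ln.
  - now apply is_lim_seq_Reals.
Qed.

(** * Wallis' integrals and Stirling's formula *)

Definition wallis_int (n : nat) : R := RInt (fun x => sin x ^ n) 0 (PI / 2).

Lemma continuous_sin_pow n x : continuous (fun x => sin x ^ n) x.
Proof. apply (ex_derive_continuous (fun x => sin x ^ n)). auto_derive. exact I. Qed.

Lemma wallis_int_correct n : is_RInt (fun x => sin x ^ n) 0 (PI / 2) (wallis_int n).
Proof.
  apply (RInt_correct (fun x => sin x ^ n)), (ex_RInt_continuous (V := R_CompleteNormedModule)).
  intros; apply continuous_sin_pow.
Qed.

Lemma wallis_int_0 : wallis_int 0 = PI / 2.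
Proof.
  unfold wallis_int. simpl. rewrite RInt_const. unfold scal; simpl. unfold mult; simpl. ring.
Qed.

Lemma wallis_int_1 : wallis_int 1 = 1.
Proof.
  unfold wallis_int. apply is_RInt_unique.
  replace 1 with (minus (- cos (PI / 2)) (- cos 0))
    by (rewrite cos_PI2, cos_0; unfold minus, plus, opp; simpl; ring).
  apply (is_RInt_derive (fun x => - cos x)).
  - intros x _. auto_derive; [exact I|]. simpl. ring.
  - intros; apply continuous_sin_pow.
Qed.

(* Integrates the derivative of [sin^(n+1) cos], which vanishes at both ends. *)
Lemma wallis_int_rec n : INR (S (S n)) * wallis_int (S (S n)) = INR (S n) * wallis_int n.
Proof.
  set (df := fun x => INR (S n) * sin x ^ n - INR (S (S n)) * sin x ^ S (S n)).
  assert (H1 : is_RInt df 0 (PI / 2)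
      (INR (S n) * wallis_int n - INR (S (S n)) * wallis_int (S (S n)))).
  { apply (is_RInt_minus (V := R_NormedModule));
      apply (is_RInt_scal (V := R_NormedModule)); apply wallis_int_correct. }
  assert (H2 : is_RInt df 0 (PI / 2)
      (sin (PI / 2) ^ S n * cos (PI / 2) - sin 0 ^ S n * cos 0)).
  { apply (is_RInt_derive (fun x => sin x ^ S n * cos x)).
    - intros x _.
      replace (df x) with (INR (S n) * sin x ^ n * (cos x * cos x) - sin x ^ S n * sin x).
      + auto_derive; [exact I|]. simpl. ring.
      + unfold df.
        pose proof (sin2_cos2 x) as E. unfold Rsqr in E.
        replace (cos x * cos x) with (1 - sin x * sin x) by (rewrite <- E; ring).
        rewrite !S_INR. simpl. ring.
    - intros x _. apply (continuous_minus (V := R_NormedModule));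
        apply (continuous_scal_r (V := R_NormedModule)); apply continuous_sin_pow. }
  apply (is_RInt_unique (V := R_CompleteNormedModule)) in H1.
  apply (is_RInt_unique (V := R_CompleteNormedModule)) in H2. rewrite H1 in H2.
  rewrite cos_PI2, sin_0, pow_i in H2 by lia. lra.
Qed.

Lemma sin_bounds_PI2 x : 0 < x < PI / 2 -> 0 <= sin x <= 1.
Proof.
  intros H. split; [|apply SIN_bound]. apply sin_ge_0; pose proof PI_RGT_0; lra.
Qed.

Lemma wallis_int_decreasing n : wallis_int (S n) <= wallis_int n.
Proof.
  pose proof PI_RGT_0. unfold wallis_int. apply RInt_le; [lra| | |].
  - exists (wallis_int (S n)). apply wallis_int_correct.
  - exists (wallis_int n). apply wallis_int_correct.
  - intros x Hx. apply sin_bounds_PI2 in Hx. simpl.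
    rewrite <- (Rmult_1_l (sin x ^ n)) at 2.
    apply Rmult_le_compat_r; [now apply pow_le|lra].
Qed.

(** The recursion says exactly that this product does not change from n to n+1; its value is read
    off at n = 0. *)
Lemma wallis_int_product n : INR (S n) * wallis_int n * wallis_int (S n) = PI / 2.
Proof.
  induction n as [|n IH].
  - rewrite wallis_int_0, wallis_int_1. simpl. ring.
  - rewrite <- IH. pose proof (wallis_int_rec n) as H.
    transitivity (INR (S (S n)) * wallis_int (S (S n)) * wallis_int (S n)); [ring|].
    rewrite H. ring.
Qed.

(** Nonnegativity comes from the integrand; the value 0 is excluded by the nonzero product pi/2. *)
Lemma wallis_int_pos n : 0 < wallis_int n.
Proof.
  pose proof PI_RGT_0 as HPI.
  assert (H : 0 <= wallis_int n).
  { unfold wallis_int. apply RInt_ge_0; [lra| |].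
    - exists (wallis_int n). apply wallis_int_correct.
    - intros x Hx. apply pow_le. now apply sin_bounds_PI2. }
  destruct H as [H|H]; [exact H|]. exfalso.
  pose proof (wallis_int_product n) as E. rewrite <- H in E. lra.
Qed.

Lemma wallis_int_even n :
  wallis_int (2 * n) = PI / 2 * INR (fact (2 * n)) / (4 ^ n * INR (fact n) ^ 2).
Proof.
  induction n as [|n IH]; [simpl; rewrite wallis_int_0; field|].
  replace (2 * S n)%nat with (S (S (2 * n))) by lia.
  pose proof (wallis_int_rec (2 * n)) as H. rewrite IH in H.
  assert (HS : INR (S (S (2 * n))) <> 0) by (apply not_0_INR; lia).
  apply (Rmult_eq_reg_l (INR (S (S (2 * n))))); [|exact HS]. rewrite H.
  rewrite !fact_simpl, !mult_INR. rewrite <- (tech_pow_Rmult 4 n).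
  replace (INR (S (S (2 * n)))) with (2 * INR (S n)) by (rewrite !S_INR, mult_INR; simpl; ring).
  field. repeat split; try apply INR_fact_neq_0; try (apply pow_nonzero; lra).
  apply not_0_INR; lia.
Qed.

Lemma ln_wallis_int_even n :
  ln (wallis_int (2 * n))
  = ln (PI / 2) + ln (INR (fact (2 * n))) - 2 * INR n * ln 2 - 2 * ln (INR (fact n)).
Proof.
  rewrite wallis_int_even. set (p := PI / 2).
  assert (Hp : 0 < p) by (unfold p; pose proof PI_RGT_0; lra).
  pose proof (INR_fact_lt_0 n) as Hf. pose proof (INR_fact_lt_0 (2 * n)) as Hf2.
  assert (H4 : 0 < 4 ^ n) by (apply pow_lt; lra).
  assert (Hf' : 0 < INR (fact n) ^ 2) by now apply pow_lt.
  rewrite ln_div by now apply Rmult_lt_0_compat.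
  rewrite (ln_mult p), (ln_mult (4 ^ n)), !ln_pow by (assumption || lra).
  replace (ln 4) with (2 * ln 2)
    by (replace 4 with (2 * 2) by ring; rewrite ln_mult by lra; ring).
  simpl (INR 2). ring.
Qed.

Lemma lim_ln_succ_minus_ln : is_lim_seq (fun n => ln (INR (S n)) - ln (INR n)) 0.
Proof.
  apply is_lim_seq_le_le_loc with (u := fun _ => 0) (w := fun n => / INR n).
  - exists 1%nat. intros n Hn.
    assert (HN : 0 < INR n) by (apply lt_0_INR; lia).
    rewrite S_INR. split.
    + enough (ln (INR n) <= ln (INR n + 1)) by lra. apply ln_le; lra.
    + rewrite <- ln_div by lra.
      pose proof (exp_ineq1_le (ln ((INR n + 1) / INR n))) as H.
      rewrite exp_ln in H by (apply Rdiv_lt_0_compat; lra).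
      replace ((INR n + 1) / INR n) with (1 + / INR n) in H |- * by (field; lra). lra.
  - apply is_lim_seq_const.
  - apply (is_lim_seq_inv INR p_infty); [apply is_lim_seq_INR|easy].
Qed.

(** Writing W for the integrals, their monotonicity in the product formula gives 2n W_(2n)^2 <= pi/2
    <= (2n+1) W_(2n)^2; the logarithms of the two outer factors differ by a null sequence. *)
Lemma lim_ln_wallis :
  is_lim_seq (fun n => 2 * ln (wallis_int (2 * n)) + ln (INR (2 * n))) (ln (PI / 2)).
Proof.
  pose proof PI_RGT_0 as HPI.
  assert (Hd : is_lim_seq (fun n => ln (PI / 2) - (ln (INR (S (2 * n))) - ln (INR (2 * n))))
    (ln (PI / 2) - 0)).
  { apply is_lim_seq_minus'; [apply is_lim_seq_const|].
    apply (is_lim_seq_subseq (fun n => ln (INR (S n)) - ln (INR n)) 0 (fun n => (2 * n)%nat)).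
    - apply eventually_subseq. intros n; lia.
    - apply lim_ln_succ_minus_ln. }
  rewrite Rminus_0_r in Hd.
  apply is_lim_seq_le_le_loc with (3 := is_lim_seq_const (ln (PI / 2))) (2 := Hd).
  exists 1%nat. intros n Hn.
  assert (H2 : 0 < INR (2 * n)) by (apply lt_0_INR; lia).
  assert (H3 : 0 < INR (S (2 * n))) by (apply lt_0_INR; lia).
  pose proof (wallis_int_pos (2 * n)) as Hw.
  assert (Hln : forall c, 0 < c ->
    ln (c * wallis_int (2 * n) * wallis_int (2 * n)) = 2 * ln (wallis_int (2 * n)) + ln c).
  { intros c Hc. rewrite !ln_mult; try assumption; [ring|]. now apply Rmult_lt_0_compat. }
  split.
  - enough (ln (PI / 2) <= 2 * ln (wallis_int (2 * n)) + ln (INR (S (2 * n)))) by lra.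
    rewrite <- Hln by exact H3. apply ln_le; [lra|].
    rewrite <- (wallis_int_product (2 * n)). apply Rmult_le_compat_l; [nra|].
    apply wallis_int_decreasing.
  - rewrite <- Hln by exact H2. apply ln_le.
    + repeat apply Rmult_lt_0_compat; assumption.
    + destruct n as [|n]; [lia|]. replace (2 * S n)%nat with (S (S (2 * n))) in * by lia.
      rewrite <- (wallis_int_product (S (2 * n))).
      apply Rmult_le_compat_r; [lra|]. apply Rmult_le_compat_l; [lra|].
      apply wallis_int_decreasing.
Qed.

(** * Stirling's formula *)

Lemma nonneg_of_derive (f df : R -> R) : f 0 = 0 ->
  (forall x, 0 <= x -> is_derive f x (df x)) -> (forall x, 0 <= x -> 0 <= df x) ->
  forall x, 0 <= x -> 0 <= f x.
Proof.
  intros H0 Hd Hp x Hx.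
  destruct (MVT_gen f 0 x df) as [z [Hz E]].
  - intros z Hz. apply Hd. rewrite Rmin_left in Hz; lra.
  - intros z Hz. apply derivable_continuous_pt. exists (df z). apply is_derive_Reals, Hd.
    rewrite Rmin_left in Hz; lra.
  - rewrite Rmin_left in Hz by exact Hx. pose proof (Hp z ltac:(lra)). nra.
Qed.

(** The midpoint rule for the convex integrand 1/(1+t) on [0,x]. At x = 1/n this bound times n + 1/2
    is exactly 1. *)
Lemma ln_1p_lower x : 0 <= x -> 2 * x / (2 + x) <= ln (1 + x).
Proof.
  intros Hx. enough (0 <= ln (1 + x) - 2 * x / (2 + x)) by lra. revert x Hx.
  apply (nonneg_of_derive (fun x => ln (1 + x) - 2 * x / (2 + x))
    (fun x => x ^ 2 / ((1 + x) * (2 + x) ^ 2))).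
  - replace (1 + 0) with 1 by ring. rewrite ln_1. field.
  - intros x Hx. auto_derive; [lra|]. field. lra.
  - intros x Hx. apply Rmult_le_pos; [nra|]. apply Rlt_le, Rinv_0_lt_compat.
    apply Rmult_lt_0_compat; nra.
Qed.

(** The trapezoidal rule for the same integral. *)
Lemma ln_1p_upper x : 0 <= x -> ln (1 + x) <= x * (2 + x) / (2 * (1 + x)).
Proof.
  intros Hx. enough (0 <= x * (2 + x) / (2 * (1 + x)) - ln (1 + x)) by lra. revert x Hx.
  apply (nonneg_of_derive (fun x => x * (2 + x) / (2 * (1 + x)) - ln (1 + x))
    (fun x => x ^ 2 / (2 * (1 + x) ^ 2))).
  - replace (1 + 0) with 1 by ring. rewrite ln_1. field.
  - intros x Hx. auto_derive; [lra|]. field. lra.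
  - intros x Hx. apply Rmult_le_pos; [nra|]. apply Rlt_le, Rinv_0_lt_compat. nra.
Qed.

(** For n >= 1, the logarithm of n! e^n / n^(n+1/2). *)
Definition stirling (n : nat) : R := ln (INR (fact n)) - (INR n + 1 / 2) * ln (INR n) + INR n.

Lemma ln_fact_succ n : ln (INR (fact (S n))) = ln (INR (S n)) + ln (INR (fact n)).
Proof.
  rewrite fact_simpl, mult_INR. apply ln_mult; [apply lt_0_INR; lia|apply INR_fact_lt_0].
Qed.

(** The step is (n + 1/2) log(1 + 1/n) - 1. The midpoint bound makes it nonnegative; the trapezoidal
    one bounds it by 1/(4n(n+1)), which telescopes. *)
Lemma stirling_step n : (1 <= n)%nat ->
  0 <= stirling n - stirling (S n) <= / (4 * INR n) - / (4 * INR (S n)).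
Proof.
  intros Hn. assert (HN : 1 <= INR n) by (apply (le_INR 1); lia).
  assert (E : stirling n - stirling (S n) = (INR n + 1 / 2) * ln (1 + / INR n) - 1).
  { unfold stirling. rewrite ln_fact_succ, S_INR.
    replace (1 + / INR n) with ((INR n + 1) / INR n) by (field; lra).
    rewrite ln_div by lra. ring. }
  rewrite E, S_INR.
  assert (Hi : 0 <= / INR n) by (apply Rlt_le, Rinv_0_lt_compat; lra).
  pose proof (ln_1p_lower _ Hi) as H1. pose proof (ln_1p_upper _ Hi) as H2.
  apply (Rmult_le_compat_l (INR n + 1 / 2)) in H1; [|lra].
  apply (Rmult_le_compat_l (INR n + 1 / 2)) in H2; [|lra].
  replace ((INR n + 1 / 2) * (2 * / INR n / (2 + / INR n))) with 1 in H1
    by (field; lra).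
  replace ((INR n + 1 / 2) * (/ INR n * (2 + / INR n) / (2 * (1 + / INR n))))
    with (1 + (/ (4 * INR n) - / (4 * (INR n + 1)))) in H2 by (field; lra).
  lra.
Qed.

Lemma stirling_cv : exists c : R, is_lim_seq stirling c.
Proof.
  destruct (growing_cv (fun n => - stirling (S n))) as [l Hl].
  - intros n. pose proof (stirling_step (S n) ltac:(lia)). lra.
  - exists (- stirling 1 + 1 / 4). intros y [n ->].
    (* The subtracted 1/(4(n+1)) strengthens the bound so that the induction telescopes. *)
    assert (H : - stirling (S n) <= - stirling 1 + 1 / 4 - / (4 * INR (S n))).
    { induction n as [|n IH]; [simpl; lra|].
      pose proof (stirling_step (S n) ltac:(lia)). lra. }
    assert (0 < / (4 * INR (S n))).
    { apply Rinv_0_lt_compat. pose proof (lt_0_INR (S n) ltac:(lia)). lra. }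
    lra.
  - exists (- l). apply is_lim_seq_incr_1.
    apply is_lim_seq_ext with (u := fun n => - - stirling (S n)); [intros; ring|].
    apply (is_lim_seq_opp _ l). now apply is_lim_seq_Reals.
Qed.

Lemma is_lim_seq_mul_index (u : nat -> R) (l : R) N : (0 < N)%nat ->
  is_lim_seq u l -> is_lim_seq (fun n => u (N * n)%nat) l.
Proof.
  intros HN H. apply (is_lim_seq_subseq u l (fun n => (N * n)%nat)); [|exact H].
  apply eventually_subseq. intros n. nia.
Qed.

(** If c is the limit, 2 [stirling] n - [stirling] (2n) tends to c. The same combination is an
    expression in the Wallis integral W_(2n), with limit (1/2) log(pi/2) + log 2 = (1/2) log(2
    pi). *)
Lemma stirling_lim : is_lim_seq stirling (ln (2 * PI) / 2).
Proof.
  destruct stirling_cv as [c Hc]. pose proof PI_RGT_0 as HPI.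
  assert (H1 : is_lim_seq (fun n => 2 * stirling n - stirling (2 * n)) (2 * c - c)).
  { apply is_lim_seq_minus'; [apply (is_lim_seq_scal_l _ 2 c Hc)|].
    apply is_lim_seq_mul_index; [lia|exact Hc]. }
  assert (H2 : is_lim_seq (fun n => 2 * stirling n - stirling (2 * n))
    (ln (PI / 2) + ln 2 - / 2 * ln (PI / 2))).
  { apply is_lim_seq_ext_loc with (u := fun n => ln (PI / 2) + ln 2 -
      / 2 * (2 * ln (wallis_int (2 * n)) + ln (INR (2 * n)))).
    - exists 1%nat. intros n Hn. assert (HN : 0 < INR n) by (apply lt_0_INR; lia).
      rewrite ln_wallis_int_even. unfold stirling.
      rewrite mult_INR, ln_mult by (simpl; lra).
      replace (INR 2) with 2 by (simpl; ring). field.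
    - apply is_lim_seq_minus'; [apply is_lim_seq_const|].
      apply (is_lim_seq_scal_l _ (/ 2) (ln (PI / 2))), lim_ln_wallis. }
  apply is_lim_seq_unique in H1. apply is_lim_seq_unique in H2. rewrite H1 in H2.
  injection H2 as H2.
  replace (ln (2 * PI) / 2) with c; [exact Hc|].
  replace (ln (2 * PI)) with (ln (PI / 2) + 2 * ln 2); [lra|].
  unfold Rdiv. rewrite !ln_mult, ln_Rinv by lra. ring.
Qed.

(** * Gauss's multiplication formula *)

Lemma ln_Rprod l : (forall x, In x l -> 0 < x) -> ln (Rprod l) = Rsum (map ln l).
Proof.
  induction l as [|x l IH]; intros H; simpl; [apply ln_1|].
  rewrite <- IH by (intros; apply H; now right).
  apply ln_mult; [apply H; now left|]. apply Rprod_pos. intros; apply H; now right.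
Qed.

Lemma ln_gauss_seq x n : 0 < x ->
  ln (gauss_seq x n) = ln (INR (fact n)) + x * ln (INR n)
    - Rsum (map (fun i => ln (x + INR i)) (seq 0 (S n))).
Proof.
  intros Hx. unfold gauss_seq.
  rewrite ln_div, ln_mult.
  - unfold Rpower. rewrite ln_exp, ln_Rprod, map_map; [reflexivity|].
    intros y Hy. apply in_map_iff in Hy. destruct Hy as [i [<- _]].
    pose proof (pos_INR i). lra.
  - apply INR_fact_lt_0.
  - apply exp_pos.
  - apply Rmult_lt_0_compat; [apply INR_fact_lt_0|apply exp_pos].
  - now apply gauss_den_pos.
Qed.

Lemma ln_fact_add A p :
  ln (INR (fact (A + p))) = ln (INR (fact A)) + Rsum (map (fun j => ln (INR (A + j))) (seq 1 p)).
Proof.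
  induction p as [|p IH]; [rewrite Nat.add_0_r; simpl; ring|].
  rewrite Nat.add_succ_r, ln_fact_succ, IH, Rsum_seq_S.
  rewrite <- Nat.add_succ_r. simpl (1 + p)%nat. ring.
Qed.

(** The numbers j/N + i run exactly once through r/N for r = 1, ..., N m. *)
Lemma sum_ln_arith N m : (0 < N)%nat ->
  Rsum (map (fun i => Rsum (map (fun j => ln (INR j / INR N + INR i)) (seq 1 N))) (seq 0 m))
  = ln (INR (fact (N * m))) - INR (N * m) * ln (INR N).
Proof.
  intros HN. assert (HN' : 0 < INR N) by (apply lt_0_INR; lia).
  induction m as [|m IH].
  - rewrite Nat.mul_0_r. simpl. rewrite ln_1. ring.
  - rewrite Rsum_seq_S, IH. simpl (0 + m)%nat.
    replace (N * S m)%nat with (N * m + N)%nat by lia.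
    rewrite ln_fact_add.
    rewrite (map_ext_in _ (fun j => ln (INR (N * m + j)) + - ln (INR N))).
    + rewrite Rsum_map_add, Rsum_const, length_seq, plus_INR. ring.
    + intros j Hj. apply in_seq in Hj.
      replace (INR j / INR N + INR m) with (INR (N * m + j) / INR N)
        by (rewrite plus_INR, mult_INR; field; lra).
      rewrite ln_div; [ring| |exact HN']. apply lt_0_INR; lia.
Qed.

Lemma Rsum_INR N : Rsum (map INR (seq 1 N)) = INR N * (INR N + 1) / 2.
Proof.
  induction N as [|N IH]; [simpl; field|].
  rewrite Rsum_seq_S, IH. change (1 + N)%nat with (S N). rewrite S_INR. field.
Qed.

(** The exponents j/N add up to (N+1)/2. The denominators have n+1 factors, so [stirling] is taken
    at n+1 and N(n+1), and passing from log n to log(n+1) leaves a correction that tends to 0. The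
    half power in Stirling's formula leaves -(1/2) log N. *)
Lemma sum_ln_gauss_seq N n : (0 < N)%nat -> (0 < n)%nat ->
  Rsum (map (fun j => ln (gauss_seq (INR j / INR N) n)) (seq 1 N))
  = INR N * stirling (S n) - stirling (N * S n)
    - (INR N + 1) / 2 * (ln (INR (S n)) - ln (INR n)) - / 2 * ln (INR N).
Proof.
  intros HN Hn. assert (HN' : 0 < INR N) by (apply lt_0_INR; lia).
  rewrite (map_ext_in _ (fun j => (ln (INR (fact n)) + ln (INR n) / INR N * INR j) +
    -1 * Rsum (map (fun i => ln (INR j / INR N + INR i)) (seq 0 (S n))))).
  - rewrite !Rsum_map_add, Rsum_const, length_seq, !Rsum_map_mul.
    change (map (fun x => INR x) (seq 1 N)) with (map INR (seq 1 N)). rewrite Rsum_INR.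
    rewrite Rsum_exchange, sum_ln_arith by exact HN.
    unfold stirling. rewrite ln_fact_succ.
    assert (HS : 0 < INR (S n)) by (apply lt_0_INR; lia).
    rewrite mult_INR, ln_mult by assumption. field. lra.
  - intros j Hj. apply in_seq in Hj. rewrite ln_gauss_seq; [field; lra|].
    apply Rdiv_lt_0_compat; [apply lt_0_INR; lia|exact HN'].
Qed.

Lemma is_lim_seq_Rsum {A} (u : A -> nat -> R) (v : A -> R) (l : list A) :
  (forall i, In i l -> is_lim_seq (u i) (v i)) ->
  is_lim_seq (fun n => Rsum (map (fun i => u i n) l)) (Rsum (map v l)).
Proof.
  induction l as [|i l IH]; intros H; simpl; [apply is_lim_seq_const|].
  apply is_lim_seq_plus'; [apply H; now left|]. apply IH. intros; apply H; now right.
Qed.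

Lemma sum_lnGamma N : (0 < N)%nat ->
  Rsum (map (fun j => lnGamma (INR j / INR N)) (seq 1 N))
  = (INR N - 1) / 2 * ln (2 * PI) - / 2 * ln (INR N).
Proof.
  intros HN. assert (HN' : 0 < INR N) by (apply lt_0_INR; lia).
  assert (H1 : is_lim_seq (fun n => Rsum (map (fun j => ln (gauss_seq (INR j / INR N) n))
      (seq 1 N))) (Rsum (map (fun j => lnGamma (INR j / INR N)) (seq 1 N)))).
  { apply (is_lim_seq_Rsum (fun j n => ln (gauss_seq (INR j / INR N) n))).
    intros j Hj. apply in_seq in Hj. apply lnGamma_lim. split.
    - apply Rdiv_lt_0_compat; [apply lt_0_INR; lia|exact HN'].
    - apply (Rmult_le_reg_r (INR N)); [exact HN'|].
      replace (INR j / INR N * INR N) with (INR j) by (field; lra).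
      rewrite Rmult_1_l. apply le_INR. lia. }
  assert (H2 : is_lim_seq (fun n => Rsum (map (fun j => ln (gauss_seq (INR j / INR N) n))
      (seq 1 N))) (INR N * (ln (2 * PI) / 2) - ln (2 * PI) / 2
        - (INR N + 1) / 2 * 0 - / 2 * ln (INR N))).
  { eapply is_lim_seq_ext_loc.
    - exists 1%nat. intros n Hn. symmetry. apply sum_ln_gauss_seq; lia.
    - apply is_lim_seq_minus'; [|apply is_lim_seq_const].
      apply is_lim_seq_minus'; [apply is_lim_seq_minus'|].
      + apply (is_lim_seq_scal_l _ _ (ln (2 * PI) / 2)).
        apply -> is_lim_seq_incr_1. apply stirling_lim.
      + apply -> (is_lim_seq_incr_1 (fun n => stirling (N * n))).
        apply is_lim_seq_mul_index; [exact HN|apply stirling_lim].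
      + apply (is_lim_seq_scal_l _ _ 0), lim_ln_succ_minus_ln. }
  apply is_lim_seq_unique in H1. apply is_lim_seq_unique in H2. rewrite H1 in H2.
  injection H2 as H2. rewrite H2. field.
Qed.

(** * The three identities *)

(** The exponent a(m-1) is negative at m = 0; the quotient form returns to natural powers. *)
Lemma powerRZ_pow_mul (x : R) a m : x <> 0 ->
  powerRZ x (Z.of_nat a * (Z.of_nat m - 1)) = (x ^ a) ^ m / x ^ a.
Proof.
  intros Hx.
  replace (Z.of_nat a * (Z.of_nat m - 1))%Z with (Z.of_nat (a * m) + - Z.of_nat a)%Z by lia.
  rewrite powerRZ_add, powerRZ_neg' by exact Hx.
  now rewrite <- !pow_powerRZ, pow_mult.
Qed.

Theorem theorem3 (n a : nat) (k : nat -> nat) (f g : nat -> arith)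
  (ha : (2 <= a)%nat)
  (hk : forall i, (1 <= i <= n)%nat -> (0 < k i)%nat) :
  let idx := seq 1 n in
  let K := lcm_list (map k idx) in
  let Ka := (K ^ a)%nat in
  let M := fun t : nat -> nat => lcm_list (map t idx) in
  let L := fun t : nat -> nat => (K / M t)%nat in
  let F := fun t : nat -> nat =>
             Cprod (map (fun i => Cmul (f i (t i)) (g i (k i / t i)%nat)) idx) in
  let G := fun j : nat => Cprod (map (fun i => s_a a (f i) (g i) (k i) j) idx) in
  let T := div_tuples k idx in
  (* (1) log Gamma *)
  Csum (map (fun j => Cscale (lnGamma (INR j / INR Ka)) (G j)) (seq 1 Ka))
  = Cadd (Cadd
      (Cscale (INR Ka / 2 * ln (2 * PI))
         (Csum (map (fun t => Cscale (/ INR (M t ^ a)) (F t)) T)))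
      (Cscale (- (1 / 2) * ln (2 * PI * INR Ka))
         (Cprod (map (fun i => dirichlet (f i) (g i) (k i)) idx))))
      (Cscale (INR a / 2)
         (Csum (map (fun t => Cscale (ln (INR (M t))) (F t)) T)))
  /\
  (* (2) binomial coefficients *)
  Csum (map (fun j => Cscale (C Ka j) (G j)) (seq 0 (S Ka)))
  = Cscale (2 ^ Ka)
      (Csum (map (fun t =>
         Cscale (/ INR (M t ^ a) *
                 Rsum (map (fun l => (-1) ^ (l * L t ^ a) *
                                     cos (PI * INR l / INR (M t ^ a)) ^ Ka)
                           (seq 1 (M t ^ a))))
                (F t)) T))
  /\
  (* (3) Bernoulli polynomials *)
  (forall m : nat,
    Csum (map (fun j => Cscale (bernpoly m (INR j / INR Ka)) (G j)) (seq 0 Ka))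
    = Cscale (bernoulli m / powerRZ (INR K) (Z.of_nat a * (Z.of_nat m - 1)))
        (Csum (map (fun t =>
           Cscale (powerRZ (INR (M t)) (Z.of_nat a * (Z.of_nat m - 1))) (F t)) T))).
Proof.
  intros idx K Ka M L F G T.
  assert (Hnd : NoDup idx) by apply seq_NoDup.
  assert (Hk : forall i, In i idx -> (0 < k i)%nat)
    by (intros i Hi; apply in_seq in Hi; apply hk; lia).
  assert (HK : (0 < K)%nat).
  { apply lcm_list_pos. intros x Hx. apply in_map_iff in Hx. destruct Hx as [i [<- Hi]]. auto. }
  (* Every [M t] divides [K], so the natural-number division in [L t] is exact. *)
  assert (HT : forall t, In t T -> (0 < M t)%nat /\ (0 < L t)%nat /\ K = (L t * M t)%nat).
  { intros t Ht. pose proof (in_div_tuples _ _ _ Ht) as Hd.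
    assert (HM : (0 < M t)%nat).
    { apply lcm_list_pos. intros x Hx. apply in_map_iff in Hx. destruct Hx as [i [<- Hi]].
      now apply (in_divisors _ (k i)), Hd. }
    assert (HMK : Nat.divide (M t) K)
      by (apply lcm_list_divide; intros i Hi; now apply in_divisors, Hd).
    destruct HMK as [q Hq].
    assert (EL : L t = q) by (unfold L; rewrite Hq; apply Nat.div_mul; lia).
    rewrite EL. repeat split; [exact HM|nia|exact Hq]. }
  assert (HTa : forall t, In t T ->
    (0 < M t ^ a)%nat /\ (0 < L t ^ a)%nat /\ Ka = (L t ^ a * M t ^ a)%nat).
  { intros t Ht. destruct (HT t Ht) as [HM [HL E]]. unfold Ka. rewrite E at 1.
    rewrite Nat.pow_mul_l. pose proof (Nat.pow_nonzero (M t) a).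
    pose proof (Nat.pow_nonzero (L t) a). repeat split; lia. }
  assert (Hswap : forall (h : nat -> R) l, Csum (map (fun j => Cscale (h j) (G j)) l)
    = Csum (map (fun t => Cscale
        (Rsum (map (fun j => if ndvd (M t ^ a) j then h j else 0) l)) (F t)) T)).
  { intros h l. rewrite <- Csum_exchange with (p := fun j t => ndvd (M t ^ a) j).
    f_equal. apply map_ext. intros j. unfold G. now rewrite Cprod_s_a by exact Hnd. }
  split; [|split].
  (* The product of the convolutions expands into the sum of the same [F t], so its factor joins the
     coefficient of each tuple. *)
  - rewrite Hswap. unfold dirichlet.
    rewrite (Cprod_Csum_divisors k (fun i d => Cmul (f i d) (g i (k i / d)%nat)) idx Hnd).
    fold T. change (fun t => Cprod (map (fun i => Cmul (f i (t i)) (g i (k i / t i)%nat)) idx))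
      with F.
    rewrite <- !Csum_scale, <- !Csum_add. f_equal. apply map_ext_in. intros t Ht.
    destruct (HTa t Ht) as [HM [HL E]]. destruct (HT t Ht) as [HM1 [HL1 _]].
    rewrite !Cscale_mul, <- !Cscale_add_l. f_equal.
    assert (HMr : 0 < INR (M t ^ a)) by now apply lt_0_INR.
    assert (HLr : 0 < INR (L t ^ a)) by now apply lt_0_INR.
    assert (HM1r : 0 < INR (M t)) by now apply lt_0_INR.
    pose proof PI_RGT_0 as HPI.
    rewrite E, Rsum_multiples_le by exact HM.
    rewrite (map_ext _ (fun i => lnGamma (INR i / INR (L t ^ a)))).
    + rewrite sum_lnGamma by exact HL. rewrite mult_INR.
      rewrite (ln_mult (2 * PI)), (ln_mult (INR (L t ^ a))) by (try apply Rmult_lt_0_compat; lra).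
      replace (ln (INR (M t ^ a))) with (INR a * ln (INR (M t)))
        by now rewrite pow_INR, ln_pow.
      field. lra.
    + intros i. f_equal. rewrite !mult_INR. field. lra.
  - rewrite Hswap, <- Csum_scale. f_equal. apply map_ext_in. intros t Ht.
    destruct (HTa t Ht) as [HM [HL E]].
    rewrite Cscale_mul. f_equal. rewrite E. now apply binomial_multiples_sum.
  - intros m. rewrite Hswap, <- Csum_scale. f_equal. apply map_ext_in. intros t Ht.
    destruct (HTa t Ht) as [HM [HL E]]. destruct (HT t Ht) as [HM1 [HL1 E1]].
    rewrite Cscale_mul. f_equal.
    assert (HMr : 0 < INR (M t ^ a)) by now apply lt_0_INR.
    assert (HLr : 0 < INR (L t ^ a)) by now apply lt_0_INR.
    assert (HM1r : 0 < INR (M t)) by now apply lt_0_INR.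
    assert (HL1r : 0 < INR (L t)) by now apply lt_0_INR.
    assert (HKr : 0 < INR K) by now apply lt_0_INR.
    rewrite E, Rsum_multiples_lt by exact HM.
    rewrite (map_ext _ (fun i => bernpoly m (INR i / INR (L t ^ a)))).
    + rewrite !powerRZ_pow_mul, <- (pow_INR K a), <- (pow_INR (M t) a) by lra.
      fold Ka. rewrite E, mult_INR, Rpow_mult_distr.
      pose proof (bernpoly_mul_sum (L t ^ a) m HL) as HB.
      (* Multiplying by (L^a)^m brings the sum to the form of [bernpoly_mul_sum]; the remaining
         powers cancel through K^a = L^a M^a. *)
      apply (Rmult_eq_reg_l (INR (L t ^ a) ^ m)); [|now apply pow_nonzero, Rgt_not_eq].
      rewrite HB. field. repeat split; try apply pow_nonzero; lra.
    + intros i. f_equal. rewrite !mult_INR. field. lra.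
Qed.
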